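(* Let $a_1 a_2 \cdots$ be a sequence of non-negative integers such that $$a_k a_{k+1} \cdots \le_{\mathrm{alt}} a_1 a_2 \cdots \quad \text{for all } k \ge 2,$$ and $$a_1 a_2 \cdots >_{\mathrm{alt}} u_1 u_2 \cdots .$$ Then there exists a unique real number $\beta > 1$ such that $$\sum_{j=1}^\infty \frac{a_j}{(-\beta)^j} = \frac{-\beta}{\beta+1} \quad \text{and} \quad \sum_{j=1}^\infty \frac{a_{k+j}}{(-\beta)^j} \in \left[\frac{-\beta}{\beta+1}, \frac{1}{\beta+1}\right] \quad \text{for all } k \ge 1.$$
   Context: The alternating lexicographic order on infinite sequences of integers is defined as follows: if $x_1 \cdots x_{k-1} = y_1 \cdots y_{k-1}$ and $x_k \ne y_k$, then $x_1 x_2 \cdots <_{\mathrm{alt}} y_1 y_2 \cdots$ if and only if $x_k < y_k$ when $k$ is odd, and $y_k < x_k$ when $k$ is even. As usual, $\le_{\mathrm{alt}}$ means $<_{\mathrm{alt}}$ or equal, and $>_{\mathrm{alt}}$ is the reverse of $<_{\mathrm{alt}}$. Let $\varphi$ be the morphism of words on the alphabet $\{0,1\}$ (i.e. compatible with concatenation) defined by $\varphi(1) = 100$, $\varphi(0) = 1$. The sequence $u_1 u_2 \cdots = 100111001001001110011\cdots$ is the infinite sequence that starts with $\varphi^n(1)$ for all $n \ge 0$. *)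

(* Defs.v *)
From Stdlib Require Import Reals ZArith Arith List Lia.
From Coquelicot Require Import Coquelicot.
Import ListNotations.

(* A sequence x_1 x_2 ... of integers is a function [x : nat -> Z] with
   [x i] = x_{i+1}.  Hence [suffix k x] is x_{k+1} x_{k+2} ... *)
Definition suffix (k : nat) (x : nat -> Z) : nat -> Z := fun i => x (k + i)%nat.

(* [k] is the 0-based first position of disagreement, so [Nat.even k] is the
   case of an odd 1-based position. *)
Definition alt_lt (x y : nat -> Z) : Prop :=
  exists k : nat,
    (forall i : nat, (i < k)%nat -> x i = y i) /\
    (if Nat.even k then (x k < y k)%Z else (y k < x k)%Z).

Definition alt_le (x y : nat -> Z) : Prop :=
  alt_lt x y \/ (forall i : nat, x i = y i).

(* Words on {0,1}, with [true] for the letter 1 and [false] for 0. *)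
Definition phi (w : list bool) : list bool :=
  flat_map (fun c : bool => if c then [true; false; false] else [true]) w.

Definition phi_pow (n : nat) (w : list bool) : list bool := Nat.iter n phi w.

(* [phi_pow n [true]] has more than [n] letters ([length_phi_pow]), so the
   default value of [nth] is never used; [u_starts_with] is the defining
   property of the sequence. *)
Definition u : nat -> Z := fun i => Z.b2z (nth i (phi_pow i [true]) false).

Definition starts_with (x : nat -> Z) (w : list bool) : Prop :=
  forall i : nat, (i < length w)%nat -> x i = Z.b2z (nth i w false).

(* The j-th term (0-based) of the sum over j >= 1 of x_j / (- beta)^j. *)
Definition neg_base_term (beta : R) (x : nat -> Z) (j : nat) : R :=
  (IZR (x j) / (- beta) ^ S j)%R.

Lemma phi_pow_app (n : nat) (v w : list bool) :
  phi_pow n (v ++ w) = phi_pow n v ++ phi_pow n w.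
Proof.
  induction n as [|n IH]; [reflexivity|].
  change (phi (phi_pow n (v ++ w)) = phi (phi_pow n v) ++ phi (phi_pow n w)).
  rewrite IH; apply flat_map_app.
Qed.

Lemma phi_pow_S (n : nat) :
  phi_pow (S n) [true] = phi_pow n [true] ++ phi_pow n [false; false].
Proof.
  rewrite <- phi_pow_app; unfold phi_pow; rewrite Nat.iter_succ_r; reflexivity.
Qed.

Lemma length_phi (w : list bool) : (length w <= length (phi w))%nat.
Proof. induction w as [|[] w IH]; simpl; lia. Qed.

Lemma length_phi_pow_le (n : nat) (w : list bool) :
  (length w <= length (phi_pow n w))%nat.
Proof.
  induction n as [|n IH]; [simpl; lia|].
  change (length w <= length (phi (phi_pow n w)))%nat.
  pose proof (length_phi (phi_pow n w)); lia.
Qed.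

Lemma length_phi_pow (n : nat) : (n < length (phi_pow n [true]))%nat.
Proof.
  induction n as [|n IH]; [simpl; lia|].
  rewrite phi_pow_S, length_app.
  pose proof (length_phi_pow_le n [false; false]) as H; simpl in H; lia.
Qed.

Lemma phi_pow_prefix (n m : nat) :
  (n <= m)%nat -> exists w, phi_pow m [true] = phi_pow n [true] ++ w.
Proof.
  induction 1 as [|m _ [w IH]].
  - exists []; now rewrite app_nil_r.
  - exists (w ++ phi_pow m [false; false]).
    now rewrite phi_pow_S, IH, app_assoc.
Qed.

Lemma u_starts_with (n : nat) : starts_with u (phi_pow n [true]).
Proof.
  intros i Hi; unfold u; f_equal.
  pose proof (length_phi_pow i) as Hl.
  destruct (Nat.le_ge_cases n i) as [H|H];
    destruct (phi_pow_prefix _ _ H) as [w Hw]; rewrite Hw, app_nth1;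
    auto.
Qed.

Example u_first_letters :
  map u (seq 0 21) =
  [1; 0; 0; 1; 1; 1; 0; 0; 1; 0; 0; 1; 0; 0; 1; 1; 1; 0; 0; 1; 1]%Z.
Proof. reflexivity. Qed.

(* Main.v *)
Require Import Defs.
From Stdlib Require Import Reals ZArith Lia Lra Classical IndefiniteDescription.
From Coquelicot Require Import Coquelicot.

(** Put s_k = sum_(j >= 1) a_(k+j) / (-beta)^j + beta / (beta+1).  The two
    conditions on beta say exactly that the recursion
      s_0 = 0,  s_(k+1) = beta (1 - s_k) - a_(k+1)
    never leaves [0,1] ([series_iff_in_unit]): the remainders of the series are
    bounded quantities divided by (-beta)^n.

    For large beta the recursion expands enough for direct arguments, but
    beta may be arbitrarily close to 1.  This is repaired by renormalisation.
    If a_1 = 1 and a is smaller than 1 0 0 0 ..., then maximality forces a to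
    be a concatenation of blocks 1 0^(2j) ([maximal_blocks]), that is
    a = psi(c) with psi(j) = 1 0^(2j), where c is again a maximal sequence of
    non-negative integers ([blocks_maximal]).  The map psi extends phi and
    respects the alternating order, so c is again larger than u = psi(u)
    ([blocks_u]), and c differs from u strictly earlier than a does
    ([blocks_first_difference]); hence the renormalisation can be iterated only
    finitely often.  To be stable under it, the recursion is generalised to
    two parameters: the digit j acts by t |-> A^j (x (1 - t)), where
    A v = y (v - 1).  The original recursion is x = beta, y = 1, and
    following the orbit only at the beginnings of the blocks, rescaled by
    (x-1)/x, gives the same recursion for c with x y and x^2 in place of x and
    y ([in_unit_blocks]).  So x and y remain powers of beta.

    It remains to treat the maximal sequences a with a_1 >= 2 or
    a >= 1 0 0 0 ... ([terminal]).  There the orbit can stay in [0,1] only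
    if x <= y (x^2 - 1) ([terminal_expansion]).

    Uniqueness ([two_bases_absurd]): if two bases had orbits in [0,1], the
    difference of the orbits would start with some d > 0, be at least d at every
    odd time because of this inequality, and its excess over d would grow
    by a factor x^2 > 1 every two steps.

    Existence ([terminal_exists]): a nested sequence of intervals of bases is
    constructed, the n-th one consisting of bases whose orbits are in [0,1]
    up to time n.  At each end of the n-th interval the orbit has either just
    reached 1, or returned to 0 at some time k and repeated its own beginning
    since then (or, at the left end, it may sit at the fixed point of the digit
    0).  The next digit continues the repetition, or maximality of a decides on
    which side of [0,1] the new value lies ([endpoint_next]).  It is always the
    side that lets an intermediate value argument cut out the next interval,
    even where the orbit is not monotone in the base. *)

Local Open Scope nat_scope.

(** * Alternating order and maximal sequences *)

Definition alt_lt_at (n : nat) (x y : nat -> nat) : Prop :=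
  (forall i, i < n -> x i = y i) /\
  (if Nat.even n then x n < y n else y n < x n).

(** Stated negatively, which for a total order is the same as saying that no
    shift exceeds [b]; in this form it refutes a given first difference
    directly. *)
Definition maximal (b : nat -> nat) : Prop :=
  forall k n, ~ alt_lt_at n b (fun i => b (k + i)).

Lemma alt_lt_at_asym n m x y :
  alt_lt_at n x y -> alt_lt_at m y x -> False.
Proof.
  intros [H1 H2] [H3 H4].
  destruct (lt_eq_lt_dec n m) as [[H|H]|H].
  - rewrite (H3 n H) in H2. destruct (Nat.even n); lia.
  - subst m. destruct (Nat.even n); lia.
  - rewrite (H1 m H) in H4. destruct (Nat.even m); lia.
Qed.

Lemma alt_lt_at_unique n m x y :
  alt_lt_at n x y -> alt_lt_at m x y -> n = m.
Proof.
  intros [H1 H2] [H3 H4].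
  destruct (lt_eq_lt_dec n m) as [[H|H]|H]; auto; exfalso.
  - rewrite (H3 n H) in H2. destruct (Nat.even n); lia.
  - rewrite (H1 m H) in H4. destruct (Nat.even m); lia.
Qed.

Lemma maximal_le_first b k : maximal b -> b k <= b 0.
Proof.
  intros Hb. destruct (le_lt_dec (b k) (b 0)) as [H|H]; auto.
  exfalso. apply (Hb k 0). split; [lia|]. cbn. now rewrite Nat.add_0_r.
Qed.

Lemma least_witness (P : nat -> Prop) n :
  P n -> exists m, m <= n /\ P m /\ forall i, i < m -> ~ P i.
Proof.
  induction n as [n IH] using lt_wf_ind. intros Hn.
  destruct (classic (exists i, i < n /\ P i)) as [[i [Hi HP]]|H].
  - destruct (IH i Hi HP) as [m [Hm H]]. exists m. split; [lia|exact H].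
  - exists n. repeat split; auto. intros i Hi HP. apply H. eauto.
Qed.

(** * Concatenations of blocks 1 0^(2j) *)

(** [b] is the image of [c] under the substitution j |-> 1 0^(2j), the i-th
    block beginning at [pos i]. *)
Record blocks (b c pos : nat -> nat) : Prop := {
  blocks_start : pos 0 = 0;
  blocks_next : forall i, pos (S i) = pos i + 2 * c i + 1;
  blocks_one : forall i, b (pos i) = 1;
  blocks_zero : forall i t, 1 <= t <= 2 * c i -> b (pos i + t) = 0 }.

Lemma blocks_pos_ge b c pos : blocks b c pos -> forall i, i <= pos i.
Proof.
  intros H. induction i; [lia|]. rewrite (blocks_next _ _ _ H). lia.
Qed.

(** Since all blocks have odd length, the parities that govern the alternating
    order for [b] and for [c] are linked. *)
Lemma blocks_pos_even b c pos :
  blocks b c pos -> forall i, Nat.even (pos i) = Nat.even i.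
Proof.
  intros H. induction i as [|i IH].
  - now rewrite (blocks_start _ _ _ H).
  - rewrite (blocks_next _ _ _ H), Nat.even_succ, <- Nat.negb_even, <- IH.
    replace (pos i + 2 * c i + 1) with (S (pos i) + 2 * c i) by lia.
    rewrite Nat.even_add_mul_2, Nat.even_succ, <- Nat.negb_even. reflexivity.
Qed.

Lemma blocks_locate b c pos :
  blocks b c pos -> forall k, exists i t, k = pos i + t /\ t <= 2 * c i.
Proof.
  intros H. induction k as [|k (i & t & -> & Ht)].
  - exists 0, 0. rewrite (blocks_start _ _ _ H). lia.
  - destruct (le_lt_dec (S t) (2 * c i)).
    + exists i, (S t). lia.
    + exists (S i), 0. rewrite (blocks_next _ _ _ H). lia.
Qed.

Lemma blocks_shift b c pos k : blocks b c pos ->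
  blocks (fun i => b (pos k + i)) (fun i => c (k + i))
         (fun i => pos (k + i) - pos k).
Proof.
  intros H.
  assert (Hm : forall i, pos k <= pos (k + i)).
  { induction i; [rewrite Nat.add_0_r; lia|].
    rewrite Nat.add_succ_r, (blocks_next _ _ _ H). lia. }
  constructor.
  - rewrite Nat.add_0_r. lia.
  - intros i. specialize (Hm i). rewrite Nat.add_succ_r, (blocks_next _ _ _ H). lia.
  - intros i. specialize (Hm i).
    replace (pos k + (pos (k + i) - pos k)) with (pos (k + i)) by lia.
    apply (blocks_one _ _ _ H).
  - intros i t Ht. specialize (Hm i).
    replace (pos k + (pos (k + i) - pos k + t)) with (pos (k + i) + t) by lia.
    now apply (blocks_zero _ _ _ H).
Qed.

Lemma blocks_agree_pos b c pos b' c' pos' n :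
  blocks b c pos -> blocks b' c' pos' ->
  (forall i, i < n -> c i = c' i) -> forall i, i <= n -> pos i = pos' i.
Proof.
  intros H H' E. induction i as [|i IH]; intros Hi.
  - now rewrite (blocks_start _ _ _ H), (blocks_start _ _ _ H').
  - rewrite (blocks_next _ _ _ H), (blocks_next _ _ _ H'), IH, E; lia.
Qed.

Lemma blocks_agree b c pos b' c' pos' n :
  blocks b c pos -> blocks b' c' pos' ->
  (forall i, i < n -> c i = c' i) -> forall j, j < pos n -> b j = b' j.
Proof.
  intros H H' E j Hj.
  destruct (blocks_locate _ _ _ H j) as (i & t & -> & Ht).
  assert (Hi : i < n).
  { destruct (le_lt_dec n i) as [Hni|]; auto. exfalso.
    assert (Hm : pos n <= pos i).
    { clear -Hni H. induction Hni; auto. rewrite (blocks_next _ _ _ H). lia. }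
    lia. }
  rewrite (blocks_agree_pos _ _ _ _ _ _ n H H' E i) by lia.
  destruct t as [|t].
  - rewrite Nat.add_0_r, (blocks_one _ _ _ H').
    rewrite <- (blocks_agree_pos _ _ _ _ _ _ n H H' E i) by lia.
    apply (blocks_one _ _ _ H).
  - rewrite (blocks_zero _ _ _ H') by (rewrite <- E; lia).
    rewrite <- (blocks_agree_pos _ _ _ _ _ _ n H H' E i) by lia.
    apply (blocks_zero _ _ _ H). lia.
Qed.

(** The shorter block ends first: there the next block contributes a 1, whereas
    the longer block still has a 0. *)
Lemma blocks_differ b c pos b' c' pos' n :
  blocks b c pos -> blocks b' c' pos' ->
  (forall i, i < n -> c i = c' i) -> c n < c' n ->
  exists D, n < D /\ Nat.even D = negb (Nat.even n) /\
    (forall j, j < D -> b j = b' j) /\ b D = 1 /\ b' D = 0.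
Proof.
  intros H H' E L.
  pose proof (blocks_agree_pos _ _ _ _ _ _ n H H' E n (le_n n)) as Hp.
  exists (pos (S n)). repeat split.
  - apply (blocks_pos_ge _ _ _ H).
  - rewrite (blocks_pos_even _ _ _ H), Nat.even_succ, <- Nat.negb_even. reflexivity.
  - intros j Hj. rewrite (blocks_next _ _ _ H) in Hj.
    destruct (le_lt_dec (pos n) j) as [Hn|Hn].
    + remember (j - pos n) as t eqn:Et.
      replace j with (pos n + t) by lia.
      destruct t as [|t].
      * rewrite Nat.add_0_r, (blocks_one _ _ _ H), Hp.
        symmetry. apply (blocks_one _ _ _ H').
      * rewrite (blocks_zero _ _ _ H), Hp by lia.
        symmetry. apply (blocks_zero _ _ _ H'). lia.
    + now apply (blocks_agree _ _ _ _ _ _ n H H' E).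
  - apply (blocks_one _ _ _ H).
  - rewrite (blocks_next _ _ _ H), Hp.
    replace (pos' n + 2 * c n + 1) with (pos' n + (2 * c n + 1)) by lia.
    apply (blocks_zero _ _ _ H'). lia.
Qed.

(** A longer block has a 0 at an even (1-based) place relative to its own
    beginning, which makes it larger, and the odd lengths of the preceding
    blocks flip the order as many times as there are preceding digits. *)
Lemma blocks_alt_lt b c pos b' c' pos' n :
  blocks b c pos -> blocks b' c' pos' ->
  alt_lt_at n c c' -> exists D, n < D /\ alt_lt_at D b b'.
Proof.
  intros H H' [E L]. destruct (Nat.even n) eqn:En.
  - destruct (blocks_differ _ _ _ _ _ _ n H H' E L) as (D & H1 & H2 & H3 & H4 & H5).
    exists D. split; auto. split; auto. rewrite H2, En. cbn. lia.
  - destruct (blocks_differ _ _ _ _ _ _ n H' H) as (D & H1 & H2 & H3 & H4 & H5); auto.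
    { intros i Hi. symmetry. auto. }
    exists D. split; auto. split; [intros; symmetry; auto|].
    rewrite H2, En. cbn. lia.
Qed.

(** A shift of [c] corresponds to a shift of [b] to the beginning of a block. *)
Lemma blocks_maximal b c pos : blocks b c pos -> maximal b -> maximal c.
Proof.
  intros H Hb k n Hlt.
  destruct (blocks_alt_lt _ _ _ _ _ _ n H (blocks_shift _ _ _ k H) Hlt)
    as (D & _ & HD).
  exact (Hb _ _ HD).
Qed.

(** The inequality [n < K] is what makes the renormalisation terminate. *)
Lemma blocks_first_difference b c pos d e pos' K :
  blocks b c pos -> blocks d e pos' -> alt_lt_at K d b ->
  exists n, n < K /\ alt_lt_at n e c.
Proof.
  intros H H' HK.
  destruct (classic (exists i, i <= K /\ e i <> c i)) as [[i [Hi Hne]]|Hall].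
  - destruct (least_witness (fun i => e i <> c i) i Hne) as (n & Hn & Hd & Hlow).
    assert (E : forall j, j < n -> e j = c j).
    { intros j Hj. destruct (Nat.eq_dec (e j) (c j)); auto. exfalso. exact (Hlow j Hj n0). }
    assert (alt_lt_at n e c \/ alt_lt_at n c e) as [L|L].
    { unfold alt_lt_at. destruct (Nat.even n);
      destruct (lt_eq_lt_dec (e n) (c n)) as [[|]|]; try lia; auto;
      right; (split; [intros; symmetry; auto|lia]). }
    + destruct (blocks_alt_lt _ _ _ _ _ _ n H' H L) as (D & HnD & HD).
      exists n. split; auto. now rewrite (alt_lt_at_unique _ _ _ _ HK HD).
    + destruct (blocks_alt_lt _ _ _ _ _ _ n H H' L) as (D & HnD & HD).
      destruct (alt_lt_at_asym _ _ _ _ HK HD).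
  - exfalso. destruct HK as [_ HK].
    rewrite (blocks_agree _ _ _ _ _ _ (S K) H' H) in HK.
    + destruct (Nat.even K); lia.
    + intros i Hi. destruct (Nat.eq_dec (e i) (c i)); auto. exfalso. apply Hall.
      exists i. split; [lia|auto].
    + pose proof (blocks_pos_ge _ _ _ H' (S K)). lia.
Qed.

(** The second clause says that [b] is at least 1 0 0 0 ... in the alternating
    order when it begins with 1: the next nonzero digit, if there is one,
    has an odd (1-based) place. *)
Definition terminal (b : nat -> nat) : Prop :=
  1 <= b 0 /\
  (b 0 = 1 -> forall i, 1 <= i -> (forall j, 1 <= j < i -> b j = 0) ->
     b i <> 0 -> Nat.even i = true).

(** Compare the shift by [P] with [b] = 1 0^(2m) 1 ...: the first nonzero digit
    after [P] can come early only after an even number of zeros, and if it does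
    not come early, then it cannot come later than in [b]. *)
Lemma maximal_next_one b m P : maximal b -> b 0 = 1 ->
  (forall j, 1 <= j <= 2 * m -> b j = 0) -> b (2 * m + 1) = 1 -> b P = 1 ->
  exists j, (forall t, 1 <= t <= 2 * j -> b (P + t) = 0) /\ b (P + 2 * j + 1) = 1.
Proof.
  intros Hb H0 Hz H1 HP.
  assert (Hone : forall i, b i <> 0 -> b i = 1).
  { intros i Hi. pose proof (maximal_le_first b i Hb). lia. }
  destruct (classic (exists t, t <= 2 * m /\ (1 <= t /\ b (P + t) <> 0)))
    as [[t0 [Ht0 HB]]|Hall].
  - destruct (least_witness (fun t => 1 <= t /\ b (P + t) <> 0) t0 HB) as (t & Ht & [Ht1 Hbt] & Hlow).
    assert (Hzt : forall i, 1 <= i < t -> b (P + i) = 0).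
    { intros i Hi. destruct (Nat.eq_dec (b (P + i)) 0); auto.
      exfalso. apply (Hlow i); [lia|]. split; [lia|auto]. }
    destruct (Nat.Even_or_Odd t) as [[j Hj]|[j Hj]].
    + exfalso. apply (Hb P t). split.
      * intros i Hi. destruct (Nat.eq_dec i 0) as [->|].
        -- now rewrite Nat.add_0_r, HP.
        -- rewrite Hz, Hzt by lia. reflexivity.
      * replace (Nat.even t) with true by (symmetry; apply Nat.even_spec; exists j; lia).
        rewrite (Hz t) by lia. lia.
    + exists j. split.
      * intros i Hi. apply Hzt. lia.
      * replace (P + 2 * j + 1) with (P + t) by lia. auto.
  - assert (Hzt : forall i, 1 <= i <= 2 * m -> b (P + i) = 0).
    { intros i Hi. destruct (Nat.eq_dec (b (P + i)) 0); auto.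
      exfalso. apply Hall. exists i. lia. }
    exists m. split; [exact Hzt|].
    apply Hone. intros Hc. apply (Hb P (2 * m + 1)). split.
    + intros i Hi. destruct (Nat.eq_dec i 0) as [->|].
      * now rewrite Nat.add_0_r, HP.
      * rewrite Hz, Hzt by lia. reflexivity.
    + replace (Nat.even (2 * m + 1)) with false.
      2:{ now rewrite Nat.even_add, Nat.even_mul. }
      rewrite Nat.add_assoc, Hc, H1. lia.
Qed.

(** If [b] is not terminal, then it begins with 1 0^(2m) 1, so that the next 1
    can be found from every 1. *)
Lemma maximal_blocks b : maximal b -> 1 <= b 0 -> ~ terminal b ->
  exists c pos, blocks b c pos.
Proof.
  intros Hb H0 Ht.
  assert (exists i, b 0 = 1 /\ 1 <= i /\ (forall j, 1 <= j < i -> b j = 0) /\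
            b i <> 0 /\ Nat.even i = false) as (i & Hb0 & Hi & Hz & Hbi & He).
  { apply NNPP. intros Hn. apply Ht. split; auto. intros Hb0 i H1 H2 H3.
    destruct (Nat.even i) eqn:E; auto. exfalso. apply Hn. exists i. auto. }
  assert (Hodd : Nat.Odd i) by (apply Nat.odd_spec; now rewrite <- Nat.negb_even, He).
  destruct Hodd as [m Hm].
  assert (Hnext : forall P, exists j, b P = 1 ->
    (forall t, 1 <= t <= 2 * j -> b (P + t) = 0) /\ b (P + 2 * j + 1) = 1).
  { intros P. destruct (Nat.eq_dec (b P) 1) as [HP|HP]; [|now exists 0].
    destruct (maximal_next_one b m P) as [j Hj]; auto.
    - intros; apply Hz; lia.
    - rewrite <- Hm. pose proof (maximal_le_first b i Hb). lia.
    - exists j. auto. }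
  apply functional_choice in Hnext. destruct Hnext as [f Hf].
  pose (pos := fun i => Nat.iter i (fun P => P + 2 * f P + 1) 0).
  assert (Hone : forall i, b (pos i) = 1).
  { intros k. induction k as [|k IH]; [exact Hb0|]. exact (proj2 (Hf _ IH)). }
  exists (fun i => f (pos i)), pos. constructor; auto.
  intros k t Hkt. exact (proj1 (Hf _ (Hone k)) t Hkt).
Qed.

(** * The sequence u is a fixed point of the block substitution *)

Definition u_nat (i : nat) : nat := Z.to_nat (u i).

Lemma u_nat_prefix n i : i < length (phi_pow n (cons true nil)) ->
  u_nat i = Nat.b2n (List.nth i (phi_pow n (cons true nil)) false).
Proof.
  intros Hi. unfold u_nat. rewrite (u_starts_with n i Hi).
  now destruct (List.nth _ _ _).
Qed.

Lemma length_phi_cons c w : length (phi (cons c w)) = 2 * Nat.b2n c + 1 + length (phi w).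
Proof. unfold phi. cbn. rewrite List.length_app. destruct c; reflexivity. Qed.

(** The image under [phi] of the i-th letter of [w] is the block 1 0^(2 w_i), and
    it begins after the images of the previous letters. *)
Lemma nth_phi_block w i t : i < length w -> t <= 2 * Nat.b2n (List.nth i w false) ->
  length (phi (List.firstn i w)) + t < length (phi w) /\
  List.nth (length (phi (List.firstn i w)) + t) (phi w) false = Nat.eqb t 0.
Proof.
  revert i. induction w as [|c w IH]; intros i Hi Ht; [cbn in Hi; lia|].
  destruct i as [|i].
  - cbn [List.firstn]. change (length (phi nil)) with 0. cbn [List.nth] in Ht.
    rewrite length_phi_cons. split; [lia|].
    destruct c; cbn in Ht.
    + destruct t as [|[|[|t]]]; auto; lia.
    + destruct t; auto; lia.
  - cbn [List.firstn]. cbn in Hi. destruct (IH i) as [IH1 IH2]; [lia|exact Ht|].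
    rewrite !length_phi_cons. split; [lia|].
    rewrite <- IH2.
    change (phi (cons c w)) with
      ((if c then cons true (cons false (cons false nil)) else cons true nil) ++ phi w)%list.
    rewrite List.app_nth2; [f_equal|]; destruct c; cbn [length Nat.b2n]; lia.
Qed.

(** On the letters 0 and 1, the substitution j |-> 1 0^(2j) is [phi]. *)
Lemma blocks_u : exists pos, blocks u_nat u_nat pos.
Proof.
  pose (pos := fix pos (i : nat) : nat :=
    match i with 0 => 0 | S k => pos k + 2 * u_nat k + 1 end).
  assert (Hpos : forall n i, i <= length (phi_pow n (cons true nil)) ->
    pos i = length (phi (List.firstn i (phi_pow n (cons true nil))))).
  { intros n. induction i as [|i IH]; intros Hi; [reflexivity|].
    cbn [pos]. rewrite IH by lia.
    rewrite (u_nat_prefix n) by lia.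
    set (w := phi_pow n _) in *.
    assert (E : List.firstn (S i) w = (List.firstn i w ++ (List.nth i w false :: nil))%list).
    { clear -Hi. revert i Hi. induction w as [|c w IHw]; intros i Hi; [cbn in Hi; lia|].
      destruct i; [reflexivity|]. cbn [List.firstn List.nth List.app].
      f_equal. apply IHw. cbn in Hi. lia. }
    rewrite E. unfold phi. rewrite List.flat_map_app, List.length_app.
    fold (phi (List.firstn i w)). fold (phi (cons (List.nth i w false) nil)).
    rewrite length_phi_cons. cbn [phi List.flat_map length]. lia. }
  assert (Hblock : forall i t, t <= 2 * u_nat i -> u_nat (pos i + t) = if Nat.eqb t 0 then 1 else 0).
  { intros i t Ht.
    pose proof (length_phi_pow i) as Hl.
    rewrite (u_nat_prefix i i Hl) in Ht.
    destruct (nth_phi_block _ i t Hl Ht) as [H1 H2].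
    rewrite <- (Hpos i) in H1, H2 by lia.
    rewrite (u_nat_prefix (S i)); change (phi_pow (S i) (cons true nil)) with (phi (phi_pow i (cons true nil))); auto.
    rewrite H2. now destruct (Nat.eqb t 0). }
  exists pos. constructor.
  - reflexivity.
  - reflexivity.
  - intros i. rewrite <- (Nat.add_0_r (pos i)), Hblock by lia. reflexivity.
  - intros i t Ht. rewrite Hblock by lia. destruct t; [lia|reflexivity].
Qed.

Local Open Scope R_scope.

(** * The two-parameter recursion *)

Definition lower (y v : R) : R := y * (v - 1).

(** For [y = 1] this is [x * (1 - t) - j], the recursion of the base [x]. *)
Definition branch (x y : R) (j : nat) (t : R) : R := Nat.iter j (lower y) (x * (1 - t)).

Fixpoint orbit (x y : R) (b : nat -> nat) (k : nat) : R :=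
  match k with
  | O => 0
  | S n => branch x y (b n) (orbit x y b n)
  end.

Definition in_unit (x y : R) (b : nat -> nat) : Prop :=
  forall k, 0 <= orbit x y b k <= 1.

Lemma iter_lower_S j y v : Nat.iter (S j) (lower y) v = y * (Nat.iter j (lower y) v - 1).
Proof. reflexivity. Qed.

Lemma iter_lower_affine j y v w :
  Nat.iter j (lower y) v - Nat.iter j (lower y) w = y ^ j * (v - w).
Proof.
  induction j as [|j IH]; [cbn; ring|].
  rewrite !iter_lower_S. cbn [pow].
  replace (y * y ^ j * (v - w)) with (y * (y ^ j * (v - w))) by ring.
  rewrite <- IH. ring.
Qed.

(** [lower y] sends values at most 1 to values at most 0, hence once an iterate
    is at most 1, all later ones are at most 0.  This and the next lemma compare
    the images of one point under two digits [i < j]. *)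
Lemma iter_lower_le_0 i j y v : 0 <= y -> (i < j)%nat ->
  Nat.iter i (lower y) v <= 1 -> Nat.iter j (lower y) v <= 0.
Proof.
  intros Hy Hij H. induction Hij as [|j Hij IH]; rewrite iter_lower_S; nra.
Qed.

Lemma iter_lower_ge_1 i j y v : 0 < y -> (i < j)%nat ->
  0 <= Nat.iter j (lower y) v -> 1 <= Nat.iter i (lower y) v.
Proof.
  intros Hy Hij. induction Hij as [|j Hij IH]; rewrite iter_lower_S; intros H.
  - nra.
  - apply IH. nra.
Qed.

Lemma iter_lower_mono j y y' v v' : 1 <= y <= y' -> v <= v' ->
  0 <= Nat.iter j (lower y') v' -> Nat.iter j (lower y) v <= Nat.iter j (lower y') v'.
Proof.
  intros Hy Hv. induction j as [|j IH]; intros H; [exact Hv|].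
  assert (H1 : 1 <= Nat.iter j (lower y') v').
  { apply (iter_lower_ge_1 j (S j)); auto; lra. }
  rewrite !iter_lower_S. specialize (IH ltac:(lra)). nra.
Qed.

Lemma orbit_S x y b k : orbit x y b (S k) = branch x y (b k) (orbit x y b k).
Proof. reflexivity. Qed.

(** * Renormalisation *)

Lemma orbit_in_block x y b c pos i t : blocks b c pos -> 1 < x ->
  (t <= 2 * c i)%nat ->
  orbit x y b (S (pos i + t)) =
    Nat.iter t (fun v => x * (1 - v)) (y * (x * (1 - orbit x y b (pos i)) - 1)).
Proof.
  intros H Hx. induction t as [|t IH]; intros Ht.
  - rewrite Nat.add_0_r, orbit_S, (blocks_one _ _ _ H). reflexivity.
  - rewrite Nat.add_succ_r, orbit_S, IH by lia.
    rewrite <- Nat.add_succ_r, (blocks_zero _ _ _ H) by lia. reflexivity.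
Qed.

(** In the coordinate rescaled by (x-1)/x, two digits 0 act as [lower] with the
    new second parameter [x ^ 2]. *)
Lemma iter_flip_even x j v : 1 < x ->
  Nat.iter (2 * j) (fun v => x * (1 - v)) ((x - 1) / x * v) =
  (x - 1) / x * Nat.iter j (lower (x ^ 2)) v.
Proof.
  intros Hx. induction j as [|j IH]; [reflexivity|].
  replace (2 * S j)%nat with (S (S (2 * j))) by lia.
  rewrite iter_lower_S. cbn [Nat.iter nat_rect] in *. unfold Nat.iter in *. rewrite IH.
  field. lra.
Qed.

Lemma orbit_blocks x y b c pos i : blocks b c pos -> 1 < x ->
  orbit x y b (pos i) = (x - 1) / x * orbit (x * y) (x ^ 2) c i.
Proof.
  intros H Hx. induction i as [|i IH].
  - rewrite (blocks_start _ _ _ H). cbn. ring.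
  - rewrite (blocks_next _ _ _ H).
    replace (pos i + 2 * c i + 1)%nat with (S (pos i + 2 * c i)) by lia.
    rewrite (orbit_in_block _ _ _ c) by auto.
    rewrite IH, orbit_S. unfold branch. rewrite <- iter_flip_even by auto.
    f_equal. field. lra.
Qed.

(** The orbit is nonnegative after the digit 1 that begins a block only if it is
    at most (x-1)/x before, which is the end of the rescaled unit interval.
    Conversely, inside a block the orbit is obtained from its value at the end
    of the block by inverting t |-> x (1 - t), and this inverse maps
    [0,1] into itself. *)
Lemma in_unit_blocks x y b c pos : blocks b c pos -> 1 < x -> 0 < y ->
  in_unit x y b <-> in_unit (x * y) (x ^ 2) c.
Proof.
  intros H Hx Hy.
  assert (Hk : 0 < (x - 1) / x) by (apply Rdiv_lt_0_compat; lra).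
  assert (Hk1 : (x - 1) / x < 1).
  { apply Rmult_lt_reg_r with x; [lra|]. unfold Rdiv. rewrite Rmult_assoc, Rinv_l; lra. }
  split; intros HU.
  - intros i. pose proof (HU (pos i)) as H0.
    pose proof (HU (S (pos i))) as H1.
    rewrite orbit_S, (blocks_one _ _ _ H) in H1. cbn in H1. unfold lower in H1.
    rewrite (orbit_blocks _ _ _ c pos i H Hx) in H0, H1.
    set (s := orbit (x * y) (x ^ 2) c i) in *.
    replace (y * (x * (1 - (x - 1) / x * s) - 1)) with (y * (x - 1) * (1 - s)) in H1
      by (field; lra).
    assert (Hyx : 0 < y * (x - 1)) by nra.
    split; [nra|].
    destruct (Rle_lt_dec s 1) as [|Hs]; auto. exfalso.
    assert (y * (x - 1) * (1 - s) < 0) by nra. lra.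
  - assert (Hend : forall i, 0 <= orbit x y b (pos i) <= 1).
    { intros i. rewrite (orbit_blocks _ _ _ c pos i H Hx). specialize (HU i). nra. }
    assert (Hin : forall i s, (s <= 2 * c i)%nat ->
      0 <= orbit x y b (pos (S i) - s) <= 1).
    { intros i. induction s as [|s IH]; intros Hs.
      - rewrite Nat.sub_0_r. apply Hend.
      - specialize (IH ltac:(lia)).
        rewrite (blocks_next _ _ _ H) in IH |- *.
        replace (pos i + 2 * c i + 1 - s)%nat
          with (S (pos i + 2 * c i + 1 - S s)) in IH by lia.
        rewrite orbit_S in IH.
        replace (b (pos i + 2 * c i + 1 - S s))%nat with O in IH.
        + unfold branch in IH. cbn [Nat.iter nat_rect] in IH.
          set (t := orbit x y b _) in *. nra.
        + replace (pos i + 2 * c i + 1 - S s)%nat with (pos i + (2 * c i - s))%nat by lia.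
          symmetry. apply (blocks_zero _ _ _ H). lia. }
    intros k. destruct (blocks_locate _ _ _ H k) as (i & t & -> & Ht).
    destruct t as [|t].
    + rewrite Nat.add_0_r. apply Hend.
    + specialize (Hin i (2 * c i - t)%nat ltac:(lia)).
      rewrite (blocks_next _ _ _ H) in Hin.
      now replace (pos i + 2 * c i + 1 - (2 * c i - t))%nat with (pos i + S t)%nat in Hin by lia.
Qed.

(** * Uniqueness for terminal sequences *)

(** x / (x+1) is the fixed point of the digit 0. *)
Lemma orbit_zeros x y b n k : 0 < x ->
  (forall i, (n <= i < n + k)%nat -> b i = O) ->
  orbit x y b (n + k) - x / (x + 1) = (- x) ^ k * (orbit x y b n - x / (x + 1)).
Proof.
  intros Hx. induction k as [|k IH]; intros Hz.
  - rewrite Nat.add_0_r. cbn. ring.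
  - rewrite Nat.add_succ_r, orbit_S, Hz by lia. cbn [branch Nat.iter nat_rect pow].
    rewrite Rmult_assoc, <- IH by (intros; apply Hz; lia).
    unfold branch; cbn. field. lra.
Qed.

Lemma pow_neg_even x k : Nat.even k = true -> (- x) ^ k = x ^ k.
Proof.
  intros H. apply Nat.even_spec in H. destruct H as [m ->].
  rewrite !pow_mult. f_equal. ring.
Qed.

Lemma pow_neg_odd x k : Nat.even k = false -> (- x) ^ k = - x ^ k.
Proof.
  intros H. destruct k; [discriminate|]. rewrite Nat.even_succ, <- Nat.negb_even in H.
  cbn [pow]. rewrite pow_neg_even; [ring|]. now destruct (Nat.even k).
Qed.

Lemma pow_unbounded x e M : 1 < x -> 0 < e -> exists k, M < x ^ k * e.
Proof.
  intros Hx He. destruct (Pow_x_infinity x ltac:(rewrite Rabs_pos_eq; lra) (M / e + 1)) as [k Hk].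
  exists k. specialize (Hk k (le_n k)).
  rewrite Rabs_pos_eq in Hk by (apply pow_le; lra).
  apply Rge_le in Hk.
  apply Rlt_le_trans with ((M / e + 1) * e).
  - replace ((M / e + 1) * e) with (M + e) by (field; lra). lra.
  - apply Rmult_le_compat_r; lra.
Qed.

(** If [b] begins with 1, the claim says that the orbit at time 1, which is
    y (x-1), is not below the fixed point p of the digit 0.  Otherwise the
    digits 0 drive it away from p, alternately below and above; it would
    be above p when the next digit 1 comes, which needs a value of at most
    1 - 1/x < p, or it would diverge. *)
Lemma terminal_expansion x y b : 1 < x -> 1 <= y -> maximal b -> terminal b ->
  in_unit x y b -> x <= y * (x ^ 2 - 1).
Proof.
  intros Hx Hy Hb [H0 Ht] HU.
  destruct (Nat.eq_dec (b O) 1) as [E|E].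
  - specialize (Ht E).
    assert (E1 : orbit x y b 1 = y * (x - 1)).
    { cbn. rewrite E. unfold branch, lower; cbn. ring. }
    set (p := x / (x + 1)).
    assert (Hp : x * (1 - p) = p) by (unfold p; field; lra).
    assert (Hp1 : 0 < p < 1).
    { unfold p. split; [apply Rdiv_lt_0_compat; lra|].
      apply Rmult_lt_reg_r with (x + 1); [lra|]. unfold Rdiv. rewrite Rmult_assoc, Rinv_l; lra. }
    destruct (Rle_lt_dec p (orbit x y b 1)) as [Hge|Hlt].
    { rewrite E1 in Hge. assert (Hpx : p * (x + 1) = x) by (unfold p; field; lra). nra. }
    exfalso.
    destruct (classic (exists i, (1 <= i)%nat /\ b i <> O)) as [[i0 Hi0]|Hall].
    + destruct (least_witness (fun i => (1 <= i)%nat /\ b i <> O) i0 Hi0) as (i & _ & [Hi1 Hbi] & Hlow).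
      assert (Hz : forall j, (1 <= j < i)%nat -> b j = O).
      { intros j Hj. destruct (Nat.eq_dec (b j) 0); auto. exfalso. apply (Hlow j); [lia|]. split; [lia|auto]. }
      pose proof (Ht i Hi1 Hz Hbi) as He.
      destruct i as [|i]; [lia|].
      pose proof (orbit_zeros x y b 1 i ltac:(lra) ltac:(intros; apply Hz; lia)) as Ho.
      fold p in Ho. rewrite Nat.even_succ, <- Nat.negb_even in He.
      rewrite pow_neg_odd in Ho by (destruct (Nat.even i); auto; discriminate).
      assert (Hpow : 0 < x ^ i) by (apply pow_lt; lra).
      cbn [Nat.add] in Ho.
      pose proof (HU (S (S i))) as H2. rewrite orbit_S in H2. unfold branch in H2.
      assert (H3 : 1 <= Nat.iter 0 (lower y) (x * (1 - orbit x y b (S i)))).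
      { apply (iter_lower_ge_1 0 (b (S i))); [lra|lia|lra]. }
      change (1 <= x * (1 - orbit x y b (S i))) in H3.
      change (1 + i)%nat with (S i) in Ho.
      assert (0 < orbit x y b (S i) - p) by (rewrite Ho; nra).
      nra.
    + destruct (pow_unbounded x (p - orbit x y b 1) 1 Hx ltac:(lra)) as [k Hk].
      pose proof (orbit_zeros x y b 1 k ltac:(lra)) as Ho. fold p in Ho.
      assert (Hz : forall i, (1 <= i < 1 + k)%nat -> b i = O).
      { intros i Hi. destruct (Nat.eq_dec (b i) 0); auto. exfalso. apply Hall. exists i; split; [lia|auto]. }
      specialize (Ho Hz). pose proof (HU (1 + k)%nat) as H1.
      destruct (Nat.even k) eqn:Ek;
        [rewrite pow_neg_even in Ho by auto|rewrite pow_neg_odd in Ho by auto]; lra.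
  - pose proof (HU 1%nat) as H1. cbn in H1. unfold branch in H1.
    assert (H2 : 1 <= Nat.iter 1 (lower y) (x * (1 - 0))).
    { apply (iter_lower_ge_1 1 (b O)); [lra|lia|lra]. }
    cbn in H2. unfold lower in H2. nra.
Qed.

Section Two_bases.
Context (x x' y y' : R) (b : nat -> nat).
Context (Hx : 1 < x) (Hxx : x < x') (Hy : 1 <= y) (Hyy : y <= y').
Context (Hb : maximal b) (Ht : terminal b).
Context (HU : in_unit x y b) (HU' : in_unit x' y' b).

(** The two iterates are the values at 0 of the branches of the digit [j]. *)
Let gap j := Nat.iter j (lower y') x' - Nat.iter j (lower y) x.
Let diff k := orbit x' y' b k - orbit x y b k.

Lemma branch_affine X Y j t : branch X Y j t = Nat.iter j (lower Y) X - Y ^ j * X * t.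
Proof.
  unfold branch.
  pose proof (iter_lower_affine j Y (X * (1 - t)) X).
  replace (X * (1 - t) - X) with (- X * t) in H by ring. nra.
Qed.

Lemma gap_first : gap (b O) = diff 1.
Proof. unfold gap, diff. cbn. rewrite !branch_affine. ring. Qed.

(** The first digit is the largest one, and the branch of each smaller digit is
    at least 1 at 0; so each application of [lower] multiplies the gap by at
    least [y]. *)
Lemma gap_bound j : (j <= b O)%nat -> 0 < gap j /\ y ^ (b O) * gap j <= y ^ j * gap (b O).
Proof.
  assert (Hv : forall i, (i < b O)%nat -> 1 <= Nat.iter i (lower y') x').
  { intros i Hi. pose proof (HU' 1%nat) as H. cbn in H. rewrite branch_affine in H.
    apply (iter_lower_ge_1 i (b O)); auto; lra. }
  assert (Hstep : forall i, (i < b O)%nat -> y * gap i <= gap (S i)).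
  { intros i Hi. unfold gap. rewrite !iter_lower_S. specialize (Hv i Hi). nra. }
  assert (Hpos : forall i, (i <= b O)%nat -> 0 < gap i).
  { induction i as [|i IH]; intros Hi; [unfold gap; cbn; lra|].
    specialize (IH ltac:(lia)). specialize (Hstep i ltac:(lia)). nra. }
  intros Hj. split; auto.
  assert (Hall : forall d, (j + d <= b O)%nat -> y ^ d * gap j <= gap (j + d)).
  { induction d as [|d IH]; intros Hd; [rewrite Nat.add_0_r; cbn; lra|].
    rewrite Nat.add_succ_r. specialize (IH ltac:(lia)). specialize (Hstep (j + d)%nat ltac:(lia)).
    cbn [pow]. nra. }
  specialize (Hall (b O - j)%nat ltac:(lia)).
  replace (j + (b O - j))%nat with (b O) in Hall by lia.
  replace (y ^ b O) with (y ^ j * y ^ (b O - j)) by (rewrite <- pow_add; f_equal; lia).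
  rewrite Rmult_assoc. apply Rmult_le_compat_l; auto. apply pow_le; lra.
Qed.

Lemma diff_S k : diff (S k) =
  gap (b k) - (y' ^ b k * x' - y ^ b k * x) * orbit x' y' b k - y ^ b k * x * diff k.
Proof. unfold diff, gap. rewrite !orbit_S, !branch_affine. ring. Qed.

Lemma slope_lt j : y ^ j * x < y' ^ j * x'.
Proof.
  assert (H : 1 <= y ^ j) by (apply pow_R1_Rle; auto).
  assert (y ^ j <= y' ^ j) by (apply pow_incr; lra). nra.
Qed.

(** Moving the base from (x, y) to (x', y') raises a branch wherever the new
    value is nonnegative, so the difference is at least what the slope of the
    old branch gives. *)
Lemma diff_S_lower k : - (y ^ b k * x * diff k) <= diff (S k).
Proof.
  unfold diff at 2. rewrite !orbit_S.
  pose proof (HU' (S k)) as H. rewrite orbit_S in H. unfold branch in H.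
  pose proof (HU' k) as H'.
  pose proof (iter_lower_mono (b k) y y' (x * (1 - orbit x' y' b k)) (x' * (1 - orbit x' y' b k))
    ltac:(lra) ltac:(nra) ltac:(lra)) as Hm.
  fold (branch x' y' (b k) (orbit x' y' b k)) in Hm.
  fold (branch x y (b k) (orbit x' y' b k)) in Hm.
  rewrite !branch_affine in *. unfold diff. nra.
Qed.

Lemma diff_S_upper k : diff (S k) <= gap (b k) - y ^ b k * x * diff k.
Proof.
  rewrite diff_S. pose proof (slope_lt (b k)). pose proof (HU' k). nra.
Qed.

(** One step with digit [j] turns [diff k] into at most
    [gap j - y ^ j * x * diff k], where [gap_bound] controls [gap j] by [diff 1];
    the next step changes the sign of this negative value and enlarges it by a
    factor of at least x.  The inequality of
    [terminal_expansion] is what makes [diff 1] the threshold for growth.  The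
    slack [s] is used once, to get strictly above the threshold. *)
Lemma diff_growth k (s : R) : diff 1 <= diff k ->
  0 <= s -> diff (S k) <= gap (b k) - y ^ b k * x * diff k - s ->
  x ^ 2 * (diff k - diff 1) + s <= diff (S (S k)) - diff 1.
Proof.
  intros Hk Hs Hup.
  pose proof (terminal_expansion x y b Hx Hy Hb Ht HU) as Hg.
  pose proof (maximal_le_first b k Hb) as Hj.
  destruct (gap_bound (b k) Hj) as [Hgp Hgb]. rewrite gap_first in Hgb.
  assert (Hd1 : 0 < diff 1) by (rewrite <- gap_first; apply gap_bound; auto).
  pose proof (diff_S_lower (S k)) as Hlow.
  set (Y := y ^ b k) in *. set (W := y ^ b O) in *. set (Z := y ^ b (S k)) in *.
  assert (HY : 1 <= Y) by (apply pow_R1_Rle; auto).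
  assert (HZ : 1 <= Z) by (apply pow_R1_Rle; auto).
  assert (HW : y <= W).
  { unfold W. destruct Ht as [H0 _]. destruct (b O) as [|J]; [lia|].
    cbn [pow]. assert (1 <= y ^ J) by (apply pow_R1_Rle; auto). nra. }
  (* The first digit is at least 1, so [terminal_expansion] also holds for [W]. *)
  assert (HWx : x <= W * (x ^ 2 - 1)) by nra.
  set (q := diff 1 / W).
  assert (Hq : q * W = diff 1) by (unfold q; field; lra).
  assert (Hq0 : 0 < q) by (apply Rdiv_lt_0_compat; lra).
  assert (Hgq : gap (b k) <= Y * q).
  { apply Rmult_le_reg_l with W; [lra|]. nra. }
  assert (Hxq : x * q <= (x ^ 2 - 1) * diff 1).
  { rewrite <- Hq. nra. }
  assert (Hq1 : q <= diff 1) by nra.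
  assert (Hpos : x * diff k - q + s <= - diff (S k)).
  { assert (0 <= x * diff k - q) by nra. nra. }
  assert (Hp0 : 0 <= x * diff k - q) by nra.
  assert (x * (x * diff k - q + s) <= diff (S (S k))).
  { apply Rle_trans with (Z * x * (- diff (S k))); [|lra].
    apply Rle_trans with (Z * x * (x * diff k - q + s)); [|apply Rmult_le_compat_l; nra].
    apply Rmult_le_compat_r; nra. }
  nra.
Qed.

Lemma two_bases_absurd : False.
Proof.
  assert (Hd1 : 0 < diff 1) by (rewrite <- gap_first; apply gap_bound; auto).
  (* What [diff_S_upper] gives away at time 1; it is positive because the
     larger base has a positive orbit at that time. *)
  set (s := (y' ^ b 1%nat * x' - y ^ b 1%nat * x) * orbit x' y' b 1).
  assert (Hs : 0 < s).
  { unfold s. pose proof (slope_lt (b 1%nat)). pose proof (HU 1%nat).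
    unfold diff in Hd1. apply Rmult_lt_0_compat; lra. }
  assert (H3 : diff 1 + s <= diff 3).
  { pose proof (diff_growth 1 s ltac:(lra) ltac:(lra)) as H.
    rewrite (diff_S 1) in H. specialize (H ltac:(unfold s; lra)).
    lra. }
  assert (Hgrow : forall m, x ^ m * s <= diff (3 + 2 * m) - diff 1).
  { induction m as [|m IH]; [cbn [Nat.mul Nat.add pow]; lra|].
    assert (Hxm : 0 < x ^ m * s) by (apply Rmult_lt_0_compat; [apply pow_lt|]; lra).
    replace (3 + 2 * S m)%nat with (S (S (3 + 2 * m))) by lia.
    pose proof (diff_S_upper (3 + 2 * m)) as Hup.
    assert (Hge : diff 1 <= diff (3 + 2 * m)) by lra.
    rewrite <- (Rminus_0_r (gap _ - _)) in Hup.
    pose proof (diff_growth (3 + 2 * m) 0 Hge (Rle_refl 0) Hup) as H.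
    set (d := diff (3 + 2 * m)) in *.
    assert (x * (x ^ m * s) <= x * (d - diff 1)) by (apply Rmult_le_compat_l; lra).
    assert (x * (d - diff 1) <= x ^ 2 * (d - diff 1)).
    { apply Rmult_le_compat_r; [lra|]. nra. }
    cbn [pow] in *. lra. }
  destruct (pow_unbounded x s 1 Hx Hs) as [m Hm].
  specialize (Hgrow m). pose proof (HU' (3 + 2 * m)%nat) as A1. pose proof (HU (3 + 2 * m)%nat) as A2.
  unfold diff in Hgrow at 1. lra.
Qed.
End Two_bases.

(** * Trapping a continuous function and nested intervals *)

Lemma continuity_lt_near f z c : continuity f -> f z < c ->
  exists d, 0 < d /\ forall t, Rabs (t - z) < d -> f t < c.
Proof.
  intros Hf Hz. destruct (Hf z (c - f z)) as (d & Hd & H); [lra|].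
  exists d. split; [exact Hd|]. intros t Ht.
  destruct (Req_dec t z) as [->|Hne]; auto.
  specialize (H t). cbn in H. unfold R_dist in H.
  assert (Rabs (f t - f z) < c - f z).
  { apply H. split; auto. split; [exact I|auto]. }
  pose proof (Rle_abs (f t - f z)). lra.
Qed.

Lemma first_hit f l r c : continuity f -> l <= r -> f l <= c ->
  exists r', l <= r' <= r /\ (forall t, l <= t <= r' -> f t <= c) /\
    (r' = r \/ f r' = c).
Proof.
  intros Hf Hlr Hl.
  set (E := fun t => l <= t <= r /\ forall s, l <= s <= t -> f s <= c).
  destruct (completeness E) as [z [Hub Hlub]].
  { exists r. intros t [Ht _]. lra. }
  { exists l. split; [lra|]. intros s Hs. replace s with l by lra. auto. }
  assert (Hlz : l <= z).
  { apply Hub. split; [lra|]. intros s Hs. replace s with l by lra. auto. }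
  assert (Hzr : z <= r) by (apply Hlub; intros t [Ht _]; lra).
  assert (Hbelow : forall t, l <= t < z -> f t <= c).
  { intros t Ht. apply Rnot_lt_le. intros Hc.
    assert (z <= t); [|lra]. apply Hlub. intros s [Hs1 Hs2].
    apply Rnot_lt_le. intros Hts. specialize (Hs2 t). lra. }
  assert (Hz : f z <= c).
  { apply Rnot_lt_le. intros Hc.
    destruct (continuity_lt_near (- f)%F z (- c)) as (d & Hd & H).
    - now apply continuity_opp.
    - unfold opp_fct. lra.
    - destruct (Rle_lt_dec z l) as [Hzl|Hzl].
      + replace z with l in Hc by lra. lra.
      + pose proof (Rmax_l l (z - d / 2)). pose proof (Rmax_r l (z - d / 2)).
        set (t := Rmax l (z - d / 2)) in *.
        assert (t < z) by (apply Rmax_lub_lt; lra).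
        specialize (H t). specialize (Hbelow t). unfold opp_fct in H.
        rewrite Rabs_left in H by lra. lra. }
  exists z. repeat split; auto.
  - intros t Ht. destruct (Req_dec t z) as [->|]; auto. apply Hbelow. lra.
  - destruct (Req_dec z r) as [|Hne]; auto. right.
    destruct (Req_dec (f z) c) as [|Hnc]; auto. exfalso.
    destruct (continuity_lt_near f z c) as (d & Hd & H); auto; [lra|].
    pose proof (Rmin_l r (z + d / 2)). pose proof (Rmin_r r (z + d / 2)).
    set (t := Rmin r (z + d / 2)) in *.
    assert (z < t) by (apply Rmin_glb_lt; lra).
    assert (t <= z); [|lra]. apply Hub. split; [lra|].
    intros s Hs. destruct (Rle_lt_dec s z) as [Hsz|Hsz].
    + destruct (Req_dec s z) as [->|]; auto. apply Hbelow. lra.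
    + left. apply H. rewrite Rabs_pos_eq; lra.
Qed.

(** Take the first point where [f] reaches 1, and then the last point before it
    where [f] is 0. *)
Lemma trap_unit f l r : continuity f -> l <= r -> f l <= 1 -> 0 <= f r ->
  exists l' r', l <= l' /\ l' <= r' /\ r' <= r /\
    (forall t, l' <= t <= r' -> 0 <= f t <= 1) /\
    (l' = l \/ f l' = 0) /\ (r' = r \/ f r' = 1).
Proof.
  intros Hf Hlr Hl Hr.
  destruct (first_hit f l r 1 Hf Hlr Hl) as (r' & Hr' & Hle & Hend).
  destruct (first_hit (fun t => - f (- t)) (- r') (- l) 0) as (m & Hm & Hge & Hend').
  - apply (continuity_opp (fun t => f (- t))).
    apply (continuity_comp (fun t => - t) f); auto.
    apply (continuity_opp (fun t => t)). apply derivable_continuous, derivable_id.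
  - lra.
  - rewrite Ropp_involutive. destruct Hend as [->|Hend]; lra.
  - exists (- m), r'. split; [lra|]. split; [lra|]. split; [lra|]. split; [|split; auto].
    + intros t Ht. specialize (Hge (- t)). rewrite Ropp_involutive in Hge.
      specialize (Hle t). lra.
    + destruct Hend' as [->|He]; [left|right]; lra.
Qed.

Lemma nested_intervals (Inv : nat -> R -> R -> Prop) l0 r0 :
  Inv O l0 r0 -> (forall n l r, Inv n l r -> l <= r) ->
  (forall n l r, Inv n l r -> exists l' r', l <= l' /\ r' <= r /\ Inv (S n) l' r') ->
  exists z, forall n, exists l r, Inv n l r /\ l <= z <= r.
Proof.
  intros H0 Hle Hstep.
  assert (H : forall s : nat * (R * R), exists s' : R * R,
    Inv (fst s) (fst (snd s)) (snd (snd s)) ->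
    fst (snd s) <= fst s' /\ snd s' <= snd (snd s) /\ Inv (S (fst s)) (fst s') (snd s')).
  { intros (n & l & r). cbn. destruct (classic (Inv n l r)) as [Hi|Hi].
    - destruct (Hstep n l r Hi) as (l' & r' & H). now exists (l', r').
    - exists (l, r). tauto. }
  apply functional_choice in H. destruct H as [F HF].
  pose (I := fix I (n : nat) : R * R := match n with O => (l0, r0) | S k => F (k, I k) end).
  assert (HI : forall n, Inv n (fst (I n)) (snd (I n))).
  { induction n as [|n IH]; [exact H0|]. apply (HF (n, I n) IH). }
  assert (Hmon : forall n, fst (I n) <= fst (I (S n)) /\ snd (I (S n)) <= snd (I n)).
  { intros n. destruct (HF (n, I n) (HI n)) as (H1 & H2 & _). split; assumption. }
  assert (Hmon' : forall n k, fst (I n) <= fst (I (n + k)%nat) /\ snd (I (n + k)%nat) <= snd (I n)).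
  { intros n. induction k as [|k IH]; [rewrite Nat.add_0_r; lra|].
    rewrite Nat.add_succ_r. specialize (Hmon (n + k)%nat). lra. }
  assert (Hlr : forall n m, fst (I n) <= snd (I m)).
  { intros n m. pose proof (Hmon' n m). pose proof (Hmon' m n).
    rewrite (Nat.add_comm m n) in *. pose proof (Hle _ _ _ (HI (n + m)%nat)). lra. }
  destruct (completeness (fun t => exists n, t = fst (I n))) as [z [Hub Hlub]].
  - exists (snd (I O)). intros t [n ->]. apply Hlr.
  - exists (fst (I O)). eauto.
  - exists z. intros n. exists (fst (I n)), (snd (I n)). split; [apply HI|]. split.
    + apply Hub. eauto.
    + apply Hlub. intros t [m ->]. apply Hlr.
Qed.

Lemma continuity_pow n : continuity (fun t => t ^ n).
Proof. apply derivable_continuous, derivable_pow. Qed.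

Lemma continuity_iter_lower g h j : continuity g -> continuity h ->
  continuity (fun t => Nat.iter j (lower (g t)) (h t)).
Proof.
  intros Hg Hh. induction j as [|j IH]; [exact Hh|].
  apply (continuity_mult g (fun t => Nat.iter j (lower (g t)) (h t) - 1)); auto.
  apply (continuity_minus (fun t => Nat.iter j (lower (g t)) (h t)) (fun _ => 1)); auto.
  apply continuity_const. intros ? ?. reflexivity.
Qed.

Lemma continuity_orbit p q b n : continuity (fun t => orbit (t ^ p) (t ^ q) b n).
Proof.
  induction n as [|n IH]; [apply continuity_const; intros ? ?; reflexivity|].
  apply (continuity_iter_lower (fun t => t ^ q)
    (fun t => t ^ p * (1 - orbit (t ^ p) (t ^ q) b n))); [apply continuity_pow|].
  apply (continuity_mult (fun t => t ^ p) (fun t => 1 - orbit (t ^ p) (t ^ q) b n));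
    [apply continuity_pow|].
  apply (continuity_minus (fun _ => 1) (fun t => orbit (t ^ p) (t ^ q) b n)); auto.
  apply continuity_const. intros ? ?. reflexivity.
Qed.

Lemma pow_ge_base x p : 1 < x -> (1 <= p)%nat -> x <= x ^ p.
Proof.
  intros Hx Hp. destruct p as [|p]; [lia|]. cbn [pow].
  assert (1 <= x ^ p) by (apply pow_R1_Rle; lra). nra.
Qed.

(** * Existence for terminal sequences *)

Lemma orbit_shift x y b n k i : (k + i <= n)%nat -> orbit x y b k = 0 ->
  (forall j, (k + j < n)%nat -> b (k + j)%nat = b j) ->
  orbit x y b (k + i) = orbit x y b i.
Proof.
  intros Hki H0 Hb. induction i as [|i IH]; [now rewrite Nat.add_0_r|].
  rewrite Nat.add_succ_r, !orbit_S, IH, Hb by lia. reflexivity.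
Qed.

(** What is known at time [n] at an end of an interval of bases; [par] is
    [false] at the left end and [true] at the right end.  Either the orbit
    was 0 at a time [k], odd for the left end and even for the right end, and
    has repeated its beginning since then, or it is 1 at a time of the other
    parity, or, at the left end only, it is at the fixed point of the digit 0.
    The last case starts the construction for the sequences that begin with 1,
    where the orbit at time 1 vanishes only at the base 1. *)
Inductive endpoint (x y : R) (b : nat -> nat) (par : bool) (n : nat) : Prop :=
| Endpoint_zero k : (1 <= k <= n)%nat -> Nat.even k = par -> orbit x y b k = 0 ->
    (forall j, (k + j < n)%nat -> b (k + j)%nat = b j) -> endpoint x y b par n
| Endpoint_one : Nat.even n = negb par -> orbit x y b n = 1 -> endpoint x y b par n
| Endpoint_fixed : par = false -> (1 <= n)%nat -> b O = 1%nat ->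
    (forall j, (1 <= j < n)%nat -> b j = O) -> orbit x y b n = x / (x + 1) ->
    endpoint x y b par n.

(** While the next digit repeats the beginning, so does the orbit.  Otherwise
    maximality says which of the two digits is larger, according to the
    parity of [n - k], and then [iter_lower_le_0] or [iter_lower_ge_1] says on
    which side of [0,1] the new value lies.  After the value 1, every digit
    gives a value at most 0.  The fixed point of the digit 0 can only be left at
    a time whose parity is known, because [b] is at least 1 0 0 0 ... . *)
Lemma endpoint_next x y b par n : 1 < x -> 1 <= y -> maximal b -> terminal b ->
  (forall i, (i <= n)%nat -> 0 <= orbit x y b i <= 1) ->
  endpoint x y b par n ->
  (endpoint x y b par (S n) /\ 0 <= orbit x y b (S n) <= 1) \/
  (if Bool.eqb (Nat.even (S n)) par then orbit x y b (S n) <= 0 else 1 <= orbit x y b (S n)).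
Proof.
  intros Hx Hy Hb [Hb0 Ht] HU [k Hk Hpar H0 Hm|Hpar H1| -> Hn E Hz Hp].
  - destruct (Nat.eq_dec (b n) (b (n - k)%nat)) as [Heq|Hne].
    + left. split.
      * apply (Endpoint_zero _ _ _ _ _ k); auto; [lia|].
        intros j Hj. destruct (Nat.eq_dec (k + j) n) as [Hjn|Hjn].
        -- rewrite Hjn, Heq. f_equal. lia.
        -- apply Hm. lia.
      * replace (S n) with (k + S (n - k))%nat by lia.
        rewrite (orbit_shift x y b (S n)); auto; try lia.
        -- apply HU. lia.
        -- intros j Hj. destruct (Nat.eq_dec (k + j) n) as [Hjn|Hjn].
           ++ rewrite Hjn, Heq. f_equal. lia.
           ++ apply Hm. lia.
    + right.
      assert (Ho : orbit x y b n = orbit x y b (n - k)).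
      { replace n with (k + (n - k))%nat at 1 by lia.
        apply (orbit_shift x y b n); auto; lia. }
      assert (Hnot : ~ alt_lt_at (n - k) b (fun i => b (k + i)%nat)) by apply Hb.
      unfold alt_lt_at in Hnot. replace (k + (n - k))%nat with n in Hnot by lia.
      assert (Hparn : Nat.even n = Bool.eqb (Nat.even (n - k)) par).
      { replace n with (n - k + k)%nat at 1 by lia. rewrite Nat.even_add, Hpar. reflexivity. }
      rewrite Nat.even_succ, <- Nat.negb_even, Hparn.
      pose proof (HU (S (n - k)) ltac:(lia)) as Hold.
      rewrite orbit_S in Hold. rewrite orbit_S, Ho. unfold branch in *.
      assert (Hm' : forall i, (i < n - k)%nat -> b i = b (k + i)%nat)
        by (intros; symmetry; apply Hm; lia).
      destruct (Nat.even (n - k)).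
      * replace (Bool.eqb _ _) with false by now destruct par.
        apply (iter_lower_ge_1 _ (b (n - k)%nat)); try lra.
        assert (~ (b (n - k) < b n)%nat) by tauto. lia.
      * replace (Bool.eqb _ _) with true by now destruct par.
        apply (iter_lower_le_0 (b (n - k)%nat)); try lra.
        assert (~ (b n < b (n - k))%nat) by tauto. lia.
  - right. rewrite Nat.even_succ, <- Nat.negb_even, Hpar, Bool.negb_involutive, Bool.eqb_reflx.
    rewrite orbit_S, H1. unfold branch. rewrite Rminus_diag, Rmult_0_r.
    destruct (b n); [cbn; lra|].
    apply (iter_lower_le_0 0); [lra|lia|cbn; lra].
  - assert (Hfix : x * (1 - x / (x + 1)) = x / (x + 1)) by (field; lra).
    destruct (Nat.eq_dec (b n) O) as [Hbn|Hbn].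
    + left.
      assert (Ho : orbit x y b (S n) = x / (x + 1)).
      { rewrite orbit_S, Hbn, Hp. exact Hfix. }
      split; [|rewrite Ho, <- Hp; apply HU; lia].
      apply Endpoint_fixed; auto.
      intros j Hj. destruct (Nat.eq_dec j n) as [->|]; auto. apply Hz. lia.
    + right. rewrite Nat.even_succ, <- Nat.negb_even, (Ht E n Hn Hz Hbn). cbn [negb Bool.eqb].
      rewrite orbit_S, Hp. unfold branch. rewrite Hfix, <- Hp.
      apply (iter_lower_le_0 0); [lra|lia|]. cbn. apply HU. lia.
Qed.

Lemma endpoint_new x y b par n :
  (1 <= n)%nat -> orbit x y b n = (if Bool.eqb (Nat.even n) par then 0 else 1) ->
  endpoint x y b par n.
Proof.
  intros Hn H. destruct (Bool.eqb (Nat.even n) par) eqn:E.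
  - apply Bool.eqb_prop in E. apply (Endpoint_zero _ _ _ _ _ n); auto.
    intros; lia.
  - apply Endpoint_one; auto. destruct (Nat.even n), par; auto; discriminate.
Qed.

Section Existence.
Context (p q : nat) (b : nat -> nat).
Context (Hp : (1 <= p)%nat) (Hb : maximal b) (Ht : terminal b).

Let orb (n : nat) (t : R) := orbit (t ^ p) (t ^ q) b n.

Definition bracket (n : nat) (l r : R) : Prop :=
  1 < l <= r /\
  (forall t, l <= t <= r -> forall i, (i <= n)%nat -> 0 <= orb i t <= 1) /\
  endpoint (l ^ p) (l ^ q) b false n /\ endpoint (r ^ p) (r ^ q) b true n.

(** At odd times [endpoint_next] gives a value at most 1 at the left end and at
    least 0 at the right end, at even times the other way round; hence
    [trap_unit] applies to the orbit or to 1 minus the orbit. *)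
Lemma bracket_step n l r : bracket n l r ->
  exists l' r', l <= l' /\ r' <= r /\ bracket (S n) l' r'.
Proof.
  intros (Hlr & HU & Hl & Hr).
  assert (Hpow : forall t k, l <= t -> 1 <= t ^ k) by (intros; apply pow_R1_Rle; lra).
  assert (Hpow' : forall t, l <= t -> 1 < t ^ p)
    by (intros t H; pose proof (pow_ge_base t p ltac:(lra) Hp); lra).
  pose proof (endpoint_next _ _ b false n (Hpow' l (Rle_refl l)) (Hpow l q (Rle_refl l)) Hb Ht (HU l ltac:(lra)) Hl) as Nl.
  pose proof (endpoint_next _ _ b true n (Hpow' r ltac:(lra)) (Hpow r q ltac:(lra)) Hb Ht (HU r ltac:(lra)) Hr) as Nr.
  change (orbit (l ^ p) (l ^ q) b (S n)) with (orb (S n) l) in Nl.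
  change (orbit (r ^ p) (r ^ q) b (S n)) with (orb (S n) r) in Nr.
  assert (Hnew : forall e par, orb (S n) e = (if Bool.eqb (Nat.even (S n)) par then 0 else 1) ->
     endpoint (e ^ p) (e ^ q) b par (S n)) by (intros; apply endpoint_new; [lia|auto]).
  assert (Hall : forall l' r', l <= l' -> r' <= r -> (forall t, l' <= t <= r' -> 0 <= orb (S n) t <= 1) ->
    forall t, l' <= t <= r' -> forall i, (i <= S n)%nat -> 0 <= orb i t <= 1).
  { intros l' r' H1 H2 H3 t Ht' i Hi. destruct (Nat.eq_dec i (S n)) as [->|]; auto.
    apply HU; [lra|lia]. }
  destruct (Nat.even (S n)) eqn:Hev; cbn [Bool.eqb] in Nl, Nr, Hnew.
  - destruct (trap_unit (fun t => 1 - orb (S n) t) l r) as (l' & r' & H1 & H2 & H3 & H4 & H5 & H6).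
    + apply (continuity_minus (fun _ => 1) (orb (S n))).
      * apply continuity_const. intros ? ?. reflexivity.
      * apply continuity_orbit.
    + lra.
    + lra.
    + lra.
    + assert (H4' : forall t, l' <= t <= r' -> 0 <= orb (S n) t <= 1)
        by (intros t H; specialize (H4 t H); lra).
      pose proof (H4' l' ltac:(lra)). pose proof (H4' r' ltac:(lra)).
      exists l', r'. split; [lra|]. split; [lra|]. split; [lra|]. split; [apply Hall; auto|]. split.
      * destruct H5 as [->|H5]; [|apply Hnew; lra].
        destruct Nl as [[? _]|Nl]; auto. apply Hnew. lra.
      * destruct H6 as [->|H6]; [|apply Hnew; lra].
        destruct Nr as [[? _]|Nr]; auto. apply Hnew. lra.
  - destruct (trap_unit (orb (S n)) l r) as (l' & r' & H1 & H2 & H3 & H4 & H5 & H6).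
    + apply continuity_orbit.
    + lra.
    + lra.
    + lra.
    + pose proof (H4 l' ltac:(lra)). pose proof (H4 r' ltac:(lra)).
      exists l', r'. split; [lra|]. split; [lra|]. split; [lra|]. split; [apply Hall; auto|]. split.
      * destruct H5 as [->|H5]; [|apply Hnew; lra].
        destruct Nl as [[? _]|Nl]; auto. apply Hnew. lra.
      * destruct H6 as [->|H6]; [|apply Hnew; lra].
        destruct Nr as [[? _]|Nr]; auto. apply Hnew. lra.
Qed.

Lemma iter_lower_large j y v : 1 <= y -> INR j <= v -> v - INR j <= Nat.iter j (lower y) v.
Proof.
  intros Hy. induction j as [|j IH]; intros Hj; [cbn; lra|].
  rewrite S_INR in *. rewrite iter_lower_S. specialize (IH ltac:(lra)). nra.
Qed.

Lemma iter_lower_one j v : Nat.iter j (lower 1) v = v - INR j.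
Proof.
  induction j as [|j IH]; [cbn; ring|].
  rewrite iter_lower_S, IH, S_INR. ring.
Qed.

(** If the first digit is at least 2, then the orbit at time 1 is negative at the
    base 1, and a zero of it serves as left end.  If the first digit is 1, this
    zero would be the base 1 itself; the left end is then the base where the
    orbit at time 1 is the fixed point of the digit 0. *)
Lemma bracket_start : exists l r, bracket 1 l r.
Proof.
  assert (Hcase : exists l r, 1 < l < r /\ 1 < orb 1 r /\ orb 1 l <= 1 /\
    (0 <= orb 1 l -> endpoint (l ^ p) (l ^ q) b false 1)).
  { assert (H1 : forall t, orb 1 t = Nat.iter (b O) (lower (t ^ q)) (t ^ p)).
    { intros t. unfold orb. cbn. unfold branch. now rewrite Rminus_0_r, Rmult_1_r. }
    set (J := INR (b O)).
    assert (HJ : 1 <= J) by (apply (le_INR 1), Ht).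
    assert (Hr : forall r, J + 1 < r -> 1 < orb 1 r).
    { intros r Hr. rewrite H1.
      assert (r <= r ^ p) by (apply pow_ge_base; auto; lra).
      assert (1 <= r ^ q) by (apply pow_R1_Rle; lra).
      pose proof (iter_lower_large (b O) (r ^ q) (r ^ p)). fold J in H2. lra. }
    destruct (Nat.eq_dec (b O) 1) as [E|E].
    - (* A zero of [g] is a base where y (x-1) = x / (x+1). *)
      set (g := fun t : R => t ^ q * (t ^ p - 1) * (t ^ p + 1) - t ^ p).
      destruct (IVT g 1 2) as (z & Hz & Hgz).
      + apply (continuity_minus (fun t => t ^ q * (t ^ p - 1) * (t ^ p + 1)) (fun t => t ^ p)); [|apply continuity_pow].
        assert (Hc : forall c, continuity (fun t => t ^ p + c)).
        { intros c. apply (continuity_plus (fun t => t ^ p) (fun _ => c)); [apply continuity_pow|].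
          apply continuity_const. intros ? ?. reflexivity. }
        apply (continuity_mult (fun t => t ^ q * (t ^ p - 1)) (fun t => t ^ p + 1)); [|apply Hc].
        apply (continuity_mult (fun t => t ^ q) (fun t => t ^ p - 1)); [apply continuity_pow|apply (Hc (-1))].
      + lra.
      + unfold g. rewrite !pow1. lra.
      + unfold g. pose proof (pow_ge_base 2 p ltac:(lra) Hp).
        assert (1 <= 2 ^ q) by (apply pow_R1_Rle; lra).
        assert (0 < (2 ^ p - 1) * (2 ^ p + 1) - 2 ^ p) by nra.
        assert (0 <= (2 ^ q - 1) * ((2 ^ p - 1) * (2 ^ p + 1))) by (apply Rmult_le_pos; nra).
        nra.
      + assert (Hz1 : 1 < z).
        { destruct (Req_dec z 1) as [->|]; [|lra]. unfold g in Hgz. rewrite !pow1 in Hgz. lra. }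
        pose proof (pow_ge_base z p Hz1 Hp) as Hzp.
        assert (Ho : orb 1 z = z ^ p / (z ^ p + 1)).
        { rewrite H1, E. cbn. unfold lower.
          apply Rmult_eq_reg_r with (z ^ p + 1); [|lra].
          unfold g in Hgz. replace (z ^ p / (z ^ p + 1) * (z ^ p + 1)) with (z ^ p) by (field; lra). lra. }
        exists z, (J + 2). repeat split; try lra.
        * apply Hr. lra.
        * rewrite Ho. apply Rmult_le_reg_r with (z ^ p + 1); [lra|].
          replace (z ^ p / (z ^ p + 1) * (z ^ p + 1)) with (z ^ p) by (field; lra). lra.
        * intros _. apply Endpoint_fixed; auto. intros; lia.
    - assert (HJ2 : 2 <= J).
      { apply (le_INR 2). destruct Ht as [H0 _]. lia. }
      assert (Hone : orb 1 1 < 0).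
      { rewrite H1, !pow1, iter_lower_one. fold J. lra. }
      pose proof (Hr (J + 2) ltac:(lra)) as Hr2.
      destruct (IVT (orb 1) 1 (J + 2)) as (z & Hz & Hgz); try lra.
      + apply continuity_orbit.
      + assert (z <> 1) by (intros ->; lra).
        assert (z <> J + 2) by (intros ->; lra).
        exists z, (J + 2). repeat split; try lra.
        intros _. apply endpoint_new; auto. }
  destruct Hcase as (l & r & Hlr & Hr & Hl & Hend).
  destruct (trap_unit (orb 1) l r) as (l' & r' & H1 & H2 & H3 & H4 & H5 & H6); try lra.
  { apply continuity_orbit. }
  exists l', r'. split; [lra|]. split; [|split].
  - intros t Ht' i Hi. destruct i as [|[|i]]; [unfold orb; cbn; lra|auto|lia].
  - destruct H5 as [->|H5]; [apply Hend, H4; lra|apply endpoint_new; auto].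
  - destruct H6 as [->|H6]; [specialize (H4 r); lra|apply endpoint_new; auto].
Qed.

Lemma terminal_exists : exists beta, 1 < beta /\ in_unit (beta ^ p) (beta ^ q) b.
Proof.
  destruct bracket_start as (l0 & r0 & H0).
  destruct (nested_intervals (fun n => bracket (S n)) l0 r0 H0) as [z Hz].
  - intros n l r (Hlr & _). lra.
  - intros n l r H. now apply bracket_step.
  - exists z. split.
    + destruct (Hz O) as (l & r & (Hlr & _) & H). lra.
    + intros k. destruct (Hz k) as (l & r & (_ & HU & _) & H). apply (HU z H k). lia.
Qed.

End Existence.

Lemma terminal_unique p q b beta beta' : (1 <= p)%nat -> maximal b -> terminal b ->
  1 < beta -> in_unit (beta ^ p) (beta ^ q) b ->
  1 < beta' -> in_unit (beta' ^ p) (beta' ^ q) b -> beta = beta'.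
Proof.
  intros Hp Hb Ht.
  assert (Hlt : forall s t, 1 < s -> s < t -> in_unit (s ^ p) (s ^ q) b ->
    in_unit (t ^ p) (t ^ q) b -> False).
  { intros s t Hs Hst HU HU'.
    apply (two_bases_absurd (s ^ p) (t ^ p) (s ^ q) (t ^ q) b); auto.
    - pose proof (pow_ge_base s p Hs Hp). lra.
    - destruct p as [|p']; [lia|]. cbn [pow].
      assert (s ^ p' <= t ^ p') by (apply pow_incr; lra).
      assert (0 < s ^ p') by (apply pow_lt; lra). nra.
    - apply pow_R1_Rle; lra.
    - apply pow_incr; lra. }
  intros H1 HU H1' HU'.
  destruct (Rtotal_order beta beta') as [H|[H|H]]; auto; exfalso; eauto.
Qed.

(** * Induction on the renormalisations *)

(** The powers of [beta] are stable under renormalisation: (p, q) becomes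
    (p + q, 2 p).  The induction is on the place [K] of the first
    difference from u. *)
Theorem base_exists_unique K b : maximal b -> alt_lt_at K u_nat b ->
  forall p q, (1 <= p)%nat ->
  exists! beta, 1 < beta /\ in_unit (beta ^ p) (beta ^ q) b.
Proof.
  revert b. induction K as [K IH] using lt_wf_ind. intros b Hb HK p q Hp.
  assert (H0 : (1 <= b O)%nat).
  { destruct HK as [HK1 HK2]. destruct K as [|K].
    - cbn in HK2. unfold u_nat in HK2. cbn in HK2. lia.
    - rewrite <- HK1 by lia. cbn. lia. }
  destruct (classic (terminal b)) as [Ht|Ht].
  - destruct (terminal_exists p q b Hp Hb Ht) as (beta & H1 & HU).
    exists beta. split; auto. intros beta' [H1' HU'].
    now apply (terminal_unique p q b).
  - destruct (maximal_blocks b Hb H0 Ht) as (c & pos & Hc).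
    destruct blocks_u as (posu & Hu).
    destruct (blocks_first_difference _ _ _ _ _ _ K Hc Hu HK) as (n & Hn & Hlt).
    destruct (IH n Hn c (blocks_maximal _ _ _ Hc Hb) Hlt (p + q)%nat (2 * p)%nat ltac:(lia))
      as (beta & [H1 HU] & Huniq).
    assert (Hiff : forall t, 1 < t -> in_unit (t ^ p) (t ^ q) b <->
                       in_unit (t ^ (p + q)) (t ^ (2 * p)) c).
    { intros t H. rewrite pow_add. replace (2 * p)%nat with (p * 2)%nat by lia.
      rewrite pow_mult. apply (in_unit_blocks _ _ _ _ pos Hc).
      - pose proof (pow_ge_base t p H Hp). lra.
      - apply pow_lt. lra. }
    exists beta. split.
    + split; auto. now apply Hiff.
    + intros t [Ht1 HtU]. apply Huniq. split; auto. now apply Hiff.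
Qed.

(** * Series in base -beta *)

Section Series.
Context (beta : R) (a : nat -> Z) (b : nat -> nat).
Context (Hbeta : 1 < beta) (Hab : forall i, a i = Z.of_nat (b i)).

Lemma orbit_base_S k : orbit beta 1 b (S k) = beta * (1 - orbit beta 1 b k) - IZR (a k).
Proof.
  rewrite orbit_S. unfold branch. rewrite iter_lower_one, Hab, INR_IZR_INZ. reflexivity.
Qed.

(** The partial sums telescope, and the remainder is a bounded quantity divided
    by a power of -beta. *)
Lemma series_of_orbit k : in_unit beta 1 b ->
  is_series (neg_base_term beta (suffix k a)) (orbit beta 1 b k - beta / (beta + 1)).
Proof.
  intros HU.
  assert (Hsum : forall n, sum_n (neg_base_term beta (suffix k a)) n =
    orbit beta 1 b k - beta / (beta + 1) -
    (orbit beta 1 b (k + S n) - beta / (beta + 1)) / (- beta) ^ S n).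
  { induction n as [|n IH].
    - rewrite sum_O. unfold neg_base_term, suffix.
      rewrite Nat.add_0_r, Nat.add_1_r, orbit_base_S. cbn. field. lra.
    - rewrite sum_Sn, IH. unfold plus; cbn -[orbit pow].
      unfold neg_base_term, suffix. rewrite (Nat.add_succ_r k (S n)), orbit_base_S.
      cbn [pow]. field. repeat split; try apply pow_nonzero; lra. }
  set (v := orbit beta 1 b k - beta / (beta + 1)) in *.
  change (is_lim_seq (sum_n (neg_base_term beta (suffix k a))) v).
  apply (is_lim_seq_ext _ _ _ (fun n => eq_sym (Hsum n))).
  replace (Finite v) with (Finite (v - 0)) by (f_equal; ring).
  apply is_lim_seq_minus'; [apply is_lim_seq_const|].
  apply is_lim_seq_abs_0.
  assert (Hgeom : is_lim_seq (fun n => (/ beta) ^ S n) 0).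
  { apply (is_lim_seq_incr_1 (fun n => (/ beta) ^ n)). apply is_lim_seq_geom.
    rewrite Rabs_pos_eq.
    - rewrite <- Rinv_1. apply Rinv_lt_contravar; lra.
    - left. apply Rinv_0_lt_compat. lra. }
  apply (is_lim_seq_le_le (fun _ => 0) _ (fun n => (/ beta) ^ S n)); auto; [|apply is_lim_seq_const].
  intros n. split; [apply Rabs_pos|].
  unfold Rdiv at 1. rewrite Rabs_mult, Rabs_inv, <- RPow_abs, Rabs_Ropp, (Rabs_pos_eq beta), pow_inv by lra.
  assert (Hinv : 0 < / beta ^ S n) by (apply Rinv_0_lt_compat, pow_lt; lra).
  assert (Hq : 0 < beta / (beta + 1) < 1).
  { split; [apply Rdiv_lt_0_compat; lra|].
    apply Rmult_lt_reg_r with (beta + 1); [lra|].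
    unfold Rdiv. rewrite Rmult_assoc, Rinv_l; lra. }
  specialize (HU (k + S n)%nat).
  assert (Rabs (orbit beta 1 b (k + S n) - beta / (beta + 1)) <= 1) by (apply Rabs_le; lra).
  nra.
Qed.

Lemma series_shift k (v w : R) :
  is_series (neg_base_term beta (suffix k a)) v ->
  is_series (neg_base_term beta (suffix (S k) a)) w ->
  w = - beta * v - IZR (a k).
Proof.
  intros Hv Hw.
  assert (H : is_series (fun n => neg_base_term beta (suffix k a) (S n)) (w / - beta)).
  { apply (is_series_ext (fun n => scal (/ - beta) (neg_base_term beta (suffix (S k) a) n))).
    - intros n. unfold scal; cbn -[pow]; unfold mult; cbn -[pow].
      unfold neg_base_term, suffix. rewrite Nat.add_succ_r, Nat.add_succ_l.
      cbn [pow]. field. repeat split; try apply pow_nonzero; lra.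
    - replace (w / - beta) with (scal (/ - beta) w)
        by (unfold scal; cbn; unfold mult; cbn; field; lra).
      exact (is_series_scal (/ - beta) _ w Hw). }
  apply is_series_unique in Hv as Ev.
  apply is_series_unique in H as Ew.
  rewrite Series_incr_1 in Ev by (now exists v).
  rewrite Ew in Ev. rewrite <- Ev. unfold neg_base_term, suffix. rewrite Nat.add_0_r.
  cbn. field. lra.
Qed.

Lemma series_iff_in_unit :
  (is_series (neg_base_term beta a) (- beta / (beta + 1)) /\
   forall k, (1 <= k)%nat -> exists v,
     is_series (neg_base_term beta (suffix k a)) v /\
     - beta / (beta + 1) <= v <= 1 / (beta + 1)) <-> in_unit beta 1 b.
Proof.
  assert (Hq : 1 / (beta + 1) = 1 - beta / (beta + 1)) by (field; lra).
  assert (Hq' : - beta / (beta + 1) = - (beta / (beta + 1))) by (field; lra).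
  rewrite Hq, Hq'. split.
  - intros [H0 Hk].
    assert (Hv : forall k, exists v, is_series (neg_base_term beta (suffix k a)) v /\
       - (beta / (beta + 1)) <= v <= 1 - beta / (beta + 1)).
    { intros [|k]; [|apply Hk; lia]. exists (- (beta / (beta + 1))). split; [exact H0|].
      assert (0 <= 1 / (beta + 1)) by (left; apply Rdiv_lt_0_compat; lra). lra. }
    assert (Horb : forall k v, is_series (neg_base_term beta (suffix k a)) v ->
      orbit beta 1 b k = v + beta / (beta + 1)).
    { induction k as [|k IH]; intros v Hs.
      - apply is_series_unique in Hs. apply is_series_unique in H0.
        change (suffix 0 a) with a in Hs. cbn. lra.
      - destruct (Hv k) as (w & Hw & _).
        rewrite orbit_base_S, (IH w Hw), (series_shift k w v Hw Hs). field. lra. }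
    intros k. destruct (Hv k) as (v & Hs & Hb). rewrite (Horb k v Hs). lra.
  - intros HU. split.
    + pose proof (series_of_orbit 0 HU) as H. cbn in H. rewrite Rminus_0_l in H. exact H.
    + intros k _. exists (orbit beta 1 b k - beta / (beta + 1)).
      split; [now apply series_of_orbit|]. specialize (HU k). lra.
Qed.
End Series.

Theorem theorem1 (a : nat -> Z)
  (a_nonneg : forall i : nat, (0 <= a i)%Z)
  (a_max : forall k : nat, (1 <= k)%nat -> alt_le (suffix k a) a)
  (a_gt_u : alt_lt u a) :
  exists! beta : R,
    (1 < beta)%R /\
    is_series (neg_base_term beta a) (- beta / (beta + 1))%R /\
    forall k : nat, (1 <= k)%nat ->
      exists v : R,
        is_series (neg_base_term beta (suffix k a)) v /\
        (- beta / (beta + 1) <= v <= 1 / (beta + 1))%R.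
Proof.
  set (b := fun i => Z.to_nat (a i)).
  assert (Hab : forall i, a i = Z.of_nat (b i)) by (intros i; unfold b; now rewrite Z2Nat.id).
  assert (Hmax : maximal b).
  { intros k n Hlt. destruct k as [|k].
    - destruct Hlt as [_ H]. cbn in H. destruct (Nat.even n); lia.
    - assert (Hle : alt_lt (suffix (S k) a) a \/ (forall i, suffix (S k) a i = a i))
        by (apply a_max; lia).
      unfold alt_lt, suffix in Hle. destruct Hle as [(m & H1 & H2)|He].
      + apply (alt_lt_at_asym n m b (fun i => b (S k + i)%nat)); auto. split.
        * intros i Hi. specialize (H1 i Hi). rewrite !Hab in H1. lia.
        * rewrite !Hab in H2. destruct (Nat.even m); lia.
      + destruct Hlt as [_ H]. specialize (He n). rewrite !Hab in He.
        destruct (Nat.even n); lia. }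
  assert (Hu : exists K, alt_lt_at K u_nat b).
  { destruct a_gt_u as (K & H1 & H2). exists K.
    assert (Hun : forall i, u i = Z.of_nat (u_nat i)).
    { intros i. unfold u_nat. rewrite Z2Nat.id; auto. unfold u. now destruct (List.nth _ _ _). }
    split.
    - intros i Hi. specialize (H1 i Hi). rewrite Hun, Hab in H1. lia.
    - rewrite !Hun, !Hab in H2. destruct (Nat.even K); lia. }
  destruct Hu as [K HK].
  destruct (base_exists_unique K b Hmax HK 1 0 ltac:(lia)) as (beta & [H1 HU] & Huniq).
  rewrite pow_1, pow_O in HU.
  exists beta. split.
  - split; auto. now apply series_iff_in_unit with (b := b).
  - intros t [Ht Hs]. apply Huniq. split; auto. rewrite pow_1, pow_O.
    now apply series_iff_in_unit with (a := a).
Qed.
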